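(* Let $R$ be an $h$-local Prüfer domain. A torsion-free $R$-module $M$ is isomorphic to a direct sum of ideals of $R$ if it is the union of a countable ascending chain $$0 = M_0 \leq M_1 \leq \dots \leq M_n \leq \dots \quad (n<\omega)$$ of submodules, such that the following properties are satisfied for every $n<\omega$: (i) $M_n$ is isomorphic to a direct sum of ideals of $R$, (ii) $M_n$ has countable rank, and (iii) $M_n$ is pure in $M$.
   Context: A Prüfer domain is an integral domain in which every finitely generated ideal is projective. An integral domain $R$ is $h$-local if (i) every nonzero prime ideal of $R$ is contained in exactly one maximal ideal, and (ii) every nonzero element of $R$ is contained in only finitely many maximal ideals. A submodule $N$ of an $R$-module $M$ is pure in $M$ if every finite system of equations $\sum_{j=1}^m r_{ij}x_j = a_i \in N$ ($i=1,\dots,n$), with $r_{ij}\in R$, is solvable in $N$ whenever it is solvable in $M$. The rank of a torsion-free $R$-module is the cardinality of a maximal $R$-linearly independent subset. Countable means finite or countably infinite. Direct sums of ideals are direct sums of ideals of $R$ regarded as $R$-modules. *)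

(* Defs.v *)
From HB Require Import structures.
From mathcomp Require Import all_boot all_order all_algebra.
From mathcomp Require Import all_classical.

Set Implicit Arguments.
Unset Strict Implicit.
Unset Printing Implicit Defensive.

Import GRing.Theory.
Local Open Scope classical_set_scope.
Local Open Scope ring_scope.

(* [submodClosed M] is the library's bundled type of (boolean) predicates on M
   closed under 0, addition and scaling. Since every Prop is reflected by a
   bool here, its elements are exactly the submodules of M, and Leibniz equality
   coincides with having the same elements. *)
Lemma submod_ext (R : pzRingType) (M : lmodType R) (N N' : submodClosed M) :
  N =i N' -> N = N'.
Proof.
case: N => N [[n1] [n2]]; case: N' => N' [[n1'] [n2']] eqN.
have eN : N = N' by apply/funext => x; have := eqN x.
case: N' / eN n1' n2' {eqN} => n1' n2'.
by rewrite (Prop_irrelevance n1 n1') (Prop_irrelevance n2 n2').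
Qed.

Definition submod_of (R : pzRingType) (M : lmodType R) (N : submodClosed M) :=
  {x : M | x \in N}.

Section SubmoduleAsModule.
Variables (R : pzRingType) (M : lmodType R) (N : submodClosed M).
HB.instance Definition _ := SubChoice.on (submod_of N).
HB.instance Definition _ := [SubChoice_isSubLmodule of submod_of N by <:].
End SubmoduleAsModule.

Definition lmod_iso (R : pzRingType) (U V : lmodType R) : Prop :=
  exists f : {linear U -> V}, bijective f.

Definition projective (R : pzRingType) (P : lmodType R) : Prop :=
  forall (A B : lmodType R) (p : {linear A -> B}) (f : {linear P -> B}),
    (forall b : B, exists a : A, p a = b) ->
    exists g : {linear P -> A}, forall x : P, p (g x) = f x.

Definition fin_gen (R : pzRingType) (M : lmodType R) (N : submodClosed M) :
    Prop :=
  exists (n : nat) (g : 'I_n -> M), forall x : M,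
    x \in N <-> exists c : 'I_n -> R, x = \sum_(i < n) c i *: g i.

Definition torsion_free (R : idomainType) (M : lmodType R) : Prop :=
  forall (a : R) (x : M), a *: x = 0 -> a = 0 \/ x = 0.

Definition pure (R : pzRingType) (M : lmodType R) (N : submodClosed M) : Prop :=
  forall (n m : nat) (r : 'M[R]_(n, m)) (a : 'I_n -> M),
    (forall i, a i \in N) ->
    (exists x : 'I_m -> M, forall i, \sum_(j < m) r i j *: x j = a i) ->
    exists x : 'I_m -> M,
      (forall j, x j \in N) /\ (forall i, \sum_(j < m) r i j *: x j = a i).

Definition lin_indep (R : pzRingType) (M : lmodType R) (A : set M) : Prop :=
  forall (s : seq M) (c : M -> R),
    uniq s -> (forall x, x \in s -> A x) ->
    \sum_(x <- s) c x *: x = 0 -> forall x, x \in s -> c x = 0.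

Definition max_lin_indep (R : pzRingType) (M : lmodType R) (A : set M) : Prop :=
  lin_indep A /\ forall B : set M, lin_indep B -> A `<=` B -> B = A.

Definition countable_rank (R : pzRingType) (M : lmodType R) : Prop :=
  exists A : set M, max_lin_indep A /\ countable A.

Notation ideal R := (submodClosed R^o).

Definition prime_ideal (R : idomainType) (P : ideal R) : Prop :=
  (1 : R) \notin P /\
  forall x y : R, x * y \in P -> (x \in P) \/ (y \in P).

Definition maximal_ideal (R : idomainType) (m : ideal R) : Prop :=
  (1 : R) \notin m /\
  forall J : ideal R, (1 : R) \notin J -> {subset m <= J} -> J = m.

Definition prufer (R : idomainType) : Prop :=
  forall J : ideal R, fin_gen J -> projective (submod_of J).

Definition h_local (R : idomainType) : Prop :=
  (forall P : ideal R, prime_ideal P -> (exists2 x : R, x \in P & x != 0) ->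
     exists! m : ideal R, maximal_ideal m /\ {subset P <= m}) /\
  (forall x : R, x != 0 ->
     finite_set [set m : ideal R | maximal_ideal m /\ x \in m]).

(* The external direct sum of the ideals J i, as the submodule of the product
   module I -> R of the finitely supported families f with f i in J i. *)
Definition dsum_pred (R : pzRingType) (I : Type) (J : I -> ideal R) :
    pred (I -> R^o) :=
  fun f => `[< finite_set [set i | f i != 0] /\ forall i, f i \in J i >].

Section DirectSum.
Variables (R : pzRingType) (I : Type) (J : I -> ideal R).

Lemma dsum_closed : submod_closed (dsum_pred J).
Proof.
split=> [|a u v].
  apply/asboolP; split=> [|i]; last exact: rpred0.
  by rewrite (_ : mkset _ = set0) // -subset0 => i /=; rewrite eqxx.
move=> /asboolP[fu Ju] /asboolP[fv Jv]; apply/asboolP; split=> [|i].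
  apply: (@sub_finite_set _ _ ([set i | u i != 0] `|` [set i | v i != 0])).
    move=> i /= nz; case: (eqVneq (u i) 0) => [ui|]; last by left.
    right; apply: contra_neq nz => vi.
    by rewrite -[LHS]/(a *: u i + v i) ui vi scaler0 addr0.
  by rewrite finite_setU.
by rewrite -[X in X \in _]/(a *: u i + v i) rpredD // rpredZ.
Qed.

HB.instance Definition _ :=
  GRing.isSubmodClosed.Build R (I -> R^o) (dsum_pred J)
    (GRing.submod_closed_semi dsum_closed).

Definition dsum : submodClosed (I -> R^o) :=
  GRing.SubmodClosed.clone R (I -> R^o) (dsum_pred J) _.
End DirectSum.

Definition iso_dsum_ideals (R : idomainType) (M : lmodType R) : Prop :=
  exists (I : Type) (J : I -> ideal R), lmod_iso M (submod_of (dsum J)).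

(* Main.v *)
(** [M] is filtered by the pure closures [N_k] of the first [k] terms of a
sequence [v] spanning [M] up to torsion. Each [N_k.+1] lies in some [M_n], so it
suffices that in a direct sum [A] of ideals the pure closure of a finite set is
a direct summand; then [N_k.+1 = N_k + C_k] with [C_k] of rank at most one, and
a coordinate of [A] embeds [C_k] in [R]. By induction on the number of
generators, only the pure closure of a single [u] in [A] has to be split off.
This closure is [I u], where [I] is the intersection of the fractional ideals
[J_i / u_i]. Over a valuation domain [I] is one of them and the projection to
that coordinate is a retraction. Over an h-local Prüfer domain these local
choices can be glued: any two nonzero ideals [P], [Q] satisfy [s P <= Q] and
[(1 - s) Q <= P] for some [s]. *)
Require Import Defs.
From HB Require Import structures.
From mathcomp Require Import all_boot all_order all_algebra.
From mathcomp Require Import all_classical.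

Set Implicit Arguments.
Unset Strict Implicit.
Unset Printing Implicit Defensive.

Import GRing.Theory.
Local Open Scope classical_set_scope.
Local Open Scope ring_scope.

Definition mk_linear (R : pzRingType) (U V : lmodType R) (f : U -> V)
    (fP : linear f) : {linear U -> V} :=
  HB.pack f (GRing.isLinear.Build R U V _ f fP).

(** * Prime and maximal ideals, and gluing over an h-local Prüfer domain *)

Section Ideals.
Variable R : idomainType.
Implicit Types (J P Q m : ideal R) (S : set R) (x y a b d s t : R).

Lemma ideal_exists (P : R -> Prop) : P 0 ->
  (forall a x y, P x -> P y -> P (a * x + y)) ->
  exists J : ideal R, forall x, x \in J <-> P x.
Proof.
move=> P0 PD.
have H : submod_closed (fun x : R^o => `[<P x>]).
  split; first exact/asboolP.
  by move=> a x y /asboolP Px /asboolP Py; apply/asboolP/PD.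
pose J : ideal R := HB.pack (fun x : R^o => `[<P x>])
  (GRing.isSubmodClosed.Build R R^o _ (GRing.submod_closed_semi H)).
by exists J => x; split=> [/asboolP|?] //; apply/asboolP.
Qed.

Lemma ideal0 J : (0 : R) \in J.
Proof. exact: (@rpred0 _ J). Qed.

Lemma idealD J x y : x \in J -> y \in J -> x + y \in J.
Proof. exact: (@rpredD _ J). Qed.

Lemma idealMl J a x : x \in J -> a * x \in J.
Proof. exact: (@rpredZ _ R^o J a x). Qed.

Lemma idealMr J a x : x \in J -> x * a \in J.
Proof. by rewrite mulrC; exact: idealMl. Qed.

(** Covers both maximal ideals ([S] = {1}) and the prime needed in [h_local_separate]. *)
Definition maximal_avoiding S P :=
  (forall x, S x -> x \notin P) /\
  forall Q, {subset P <= Q} -> (forall x, S x -> x \notin Q) -> Q = P.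

Lemma exists_maximal_avoiding S J : (forall x, S x -> x \notin J) ->
  exists2 P : ideal R, {subset J <= P} & maximal_avoiding S P.
Proof.
move=> SJ.
pose T := {P : ideal R | {subset J <= P} /\ forall x, S x -> x \notin P}.
pose J0 : T := exist _ J (conj (fun x xJ => xJ) SJ).
pose le (P Q : T) := `[<{subset sval P <= sval Q}>].
have J0_le (P : T) : le J0 P by apply/asboolP; case: (svalP P).
have [t|r s t /asboolP rs /asboolP st|s t|A totA|P maxP] := @Zorn T le.
- exact/asboolP.
- by apply/asboolP => x /rs/st.
- move=> /asboolP st /asboolP ts; apply: eq_sig_hprop => [? ? ?|]; first exact: Prop_irrelevance.
  by apply: submod_ext => x; apply/idP/idP => [/st|/ts].
(* Adjoining [J0] keeps the union nonempty when the chain is empty. *)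
- pose A' : set T := [set P | P = J0 \/ A P].
  have totA' (P Q : T) : A' P -> A' Q -> le P Q \/ le Q P.
    move=> [->|AP]; first by left.
    by move=> [->|AQ]; [right|exact: totA].
  have [||U UP] := @ideal_exists (fun x => exists2 P : T, A' P & x \in sval P).
  + by exists J0; [left|exact: ideal0].
  + move=> a x y [P AP xP] [Q AQ yQ].
    by have [/asboolP PQ|/asboolP QP] := totA' _ _ AP AQ;
      [exists Q|exists P] => //; apply: idealD; auto; apply: idealMl; auto.
  have HU : {subset J <= U} /\ forall x, S x -> x \notin U.
    split=> [x xJ|x Sx]; first by apply/UP; exists J0 => //; left.
    apply/negP => /UP[P _ xP].
    by have [_ /(_ x Sx)] := svalP P; rewrite xP.
  exists (exist _ U HU) => P AP; apply/asboolP => x xP /=.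
  by apply/UP; exists P => //; right.
exists (sval P); first by case: (svalP P).
split=> [|Q PQ SQ]; first by case: (svalP P).
have JQ : {subset J <= Q} by move=> x xJ; apply: PQ; case: (svalP P) => /(_ x xJ).
have := maxP (exist _ Q (conj JQ SQ)).
by move=> <- //; apply/asboolP.
Qed.

(** If [x] and [y] lie outside [P], maximality makes P + Rx and P + Ry meet [S]. The product of two
    such elements is in [S], and it is in [P] as soon as [x * y] is. *)
Lemma maximal_avoiding_prime S P : S 1 ->
  (forall x y, S x -> S y -> S (x * y)) -> maximal_avoiding S P -> prime_ideal P.
Proof.
move=> S1 SM [SP maxP].
have meets x : x \notin P -> exists2 p, p \in P & exists r, S (p + r * x).
  move=> xP; apply: contrapT => nex.
  have [||Q QP] := @ideal_exists (fun z => exists2 p, p \in P &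
      exists r, z = p + r * x).
  - by exists 0; [exact: ideal0|exists 0; rewrite mul0r addr0].
  - move=> a _ _ [p pP [r ->]] [q qP [s ->]].
    exists (a * p + q); first by apply: idealD => //; apply: idealMl.
    by exists (a * r + s); rewrite mulrDr mulrDl mulrA addrACA.
  have eQ : Q = P.
    apply: maxP => [z zP|z Sz].
      by apply/QP; exists z => //; exists 0; rewrite mul0r addr0.
    by apply/negP => /QP[p pP [r zE]]; apply: nex; exists p => //; exists r; rewrite -zE.
  move/negP: xP; apply; rewrite -eQ; apply/QP.
  by exists 0; [exact: ideal0|exists 1; rewrite mul1r add0r].
split=> [|x y xyP]; first exact: SP.
apply: contrapT => /not_orP[/negP/meets[p pP [r Sx]] /negP/meets[q qP [s Sy]]].
have /negP := SP _ (SM _ _ Sx Sy); apply.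
have -> : (p + r * x) * (q + s * y) = p * (q + s * y) + (r * x * q + r * s * (x * y)).
  by rewrite mulrDl mulrDr (mulrDr (r * x)) mulrACA.
by apply: idealD; [exact: idealMr|apply: idealD; exact: idealMl].
Qed.

Lemma maximal_idealE m : maximal_ideal m <-> maximal_avoiding [set 1] m.
Proof.
split=> [[m1 mmax]|[m1 mmax]].
  by split=> [_ -> //|Q mQ Q1]; apply: mmax => //; exact: Q1.
by split=> [|Q Q1 mQ]; [exact: m1|apply: mmax => // _ ->].
Qed.

Lemma maximal_ideal_prime m : maximal_ideal m -> prime_ideal m.
Proof.
by move=> /maximal_idealE; apply: maximal_avoiding_prime => // _ _ -> ->; rewrite mul1r.
Qed.

Lemma exists_maximal_ideal J : (1 : R) \notin J ->
  exists2 m : ideal R, maximal_ideal m & {subset J <= m}.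
Proof.
move=> J1; have [|m Jm mmax] := @exists_maximal_avoiding [set 1] J.
  by move=> _ ->.
by exists m => //; apply/maximal_idealE.
Qed.

Lemma prime_ideal_notinM P x y : prime_ideal P ->
  x \notin P -> y \notin P -> x * y \notin P.
Proof. by move=> [_ PM] xP yP; apply/negP => /PM[]; apply/negP. Qed.

(** The ideal Rx + Ry is projective, so the surjection from R^2 onto it has a section [g]; [s] is
    the first coordinate of [g] at [x]. Where [s] is a unit, [x] divides [y]; where [1 - s] is a
    unit, [y] divides [x]: this is the valuation property in a form free of localisations. *)
Lemma prufer_comparable x y : prufer R ->
  exists s, (exists r, s * y = r * x) /\ (exists r, (1 - s) * x = r * y).
Proof.
move=> pR.
have [||J JP] := @ideal_exists (fun z => exists a b, z = a * x + b * y).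
- by exists 0, 0; rewrite !mul0r addr0.
- move=> a _ _ [b [c ->]] [e [f ->]]; exists (a * b + e), (a * c + f).
  by rewrite !mulrDl mulrDr !mulrA addrACA.
have xJ : (x : R^o) \in J by apply/JP; exists 1, 0; rewrite mul1r mul0r addr0.
have yJ : (y : R^o) \in J by apply/JP; exists 0, 1; rewrite mul1r mul0r add0r.
have fgJ : fin_gen J.
  exists 2%N, (fun i : 'I_2 => (if i == ord0 then x else y) : R^o).
  move=> z.
  split=> [/JP[a [b ->]]|[c ->]].
    exists (fun i : 'I_2 => if i == ord0 then a else b).
    by rewrite !big_ord_recl big_ord0 /= addr0.
  by apply/JP; exists (c ord0), (c (lift ord0 ord0)); rewrite !big_ord_recl big_ord0 /= addr0.
pose p0 (z : R^o * R^o) : R^o := (z.1 * x + z.2 * y : R).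
have p0J z : p0 z \in J by apply/JP; exists z.1, z.2.
pose p (z : R^o * R^o) : submod_of J := exist _ (p0 z) (p0J z).
have plin : linear p.
  move=> a u v; apply: val_inj => /=; rewrite /p0 /=.
  by rewrite !mulrDl addrACA -!scalerAl -scalerDr.
have [b|g gE] := pR J fgJ _ _ (mk_linear plin) (idfun : {linear _ -> _}).
  have /JP[c [e bE]] := valP b.
  by exists (c, e); apply: val_inj.
pose X : submod_of J := exist _ (x : R^o) xJ.
pose Y : submod_of J := exist _ (y : R^o) yJ.
have gx : (g X).1 * x + (g X).2 * y = x := congr1 val (gE X).
(* Both sides are the value of [g] at the product of [x] and [y]. *)
have gxy : y *: g X = x *: g Y.
  by rewrite -!linearZ; congr (g _); apply: val_inj; exact: mulrC.
have g1 : y * (g X).1 = x * (g Y).1 := congr1 fst gxy.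
exists (g X).1; split; first by exists (g Y).1; rewrite mulrC g1 mulrC.
by exists (g X).2; rewrite mulrBl mul1r -[X in X - _]gx [_ + _ * y]addrC addrK.
Qed.

(** Otherwise the products of an element outside [m] with one outside [m'] avoid Rd, and an ideal
    containing [d] and maximal among those avoiding these products is a nonzero prime inside both
    [m] and [m']. *)
Lemma h_local_separate m m' d : h_local R -> d != 0 ->
  maximal_ideal m -> maximal_ideal m' -> m' <> m ->
  exists2 a, a \notin m & exists2 b, b \notin m' & exists r, b * a = r * d.
Proof.
move=> [hR _] d0 mm mm' neq; apply: contrapT => nex.
have pm := maximal_ideal_prime mm; have pm' := maximal_ideal_prime mm'.
pose S : set R := [set z | exists2 a, a \notin m & exists2 b, b \notin m' & z = b * a].
have [||D DP] := @ideal_exists (fun z => exists r, z = r * d).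
- by exists 0; rewrite mul0r.
- by move=> a _ _ [r ->] [s ->]; exists (a * r + s); rewrite mulrDl mulrA.
have [|P DP' Pmax] := @exists_maximal_avoiding S D.
  move=> _ [a am [b bm' ->]]; apply/negP => /DP[r E].
  by apply: nex; exists a => //; exists b => //; exists r.
have m1 : (1 : R) \notin m by case: mm.
have m1' : (1 : R) \notin m' by case: mm'.
have pP : prime_ideal P.
  apply: maximal_avoiding_prime Pmax.
    by exists 1 => //; exists 1; rewrite ?mulr1.
  move=> _ _ [a am [b bm ->]] [a' am' [b' bm' ->]].
  exists (a * a'); first exact: prime_ideal_notinM.
  by exists (b * b'); [exact: prime_ideal_notinM|rewrite mulrACA].
have Pm : {subset P <= m}.
  move=> x xP; apply/negPn/negP => xm; have [/(_ x) + _] := Pmax; rewrite xP => H.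
  by case: notF; apply: H; exists x => //; exists 1 => //; rewrite mul1r.
have Pm' : {subset P <= m'}.
  move=> x xP; apply/negPn/negP => xm; have [/(_ x) + _] := Pmax; rewrite xP => H.
  by case: notF; apply: H; exists 1 => //; exists x => //; rewrite mulr1.
have [|M [_ uniqM]] := hR P pP.
  by exists d => //; apply/DP'/DP; exists 1; rewrite mul1r.
by apply: neq; rewrite -(uniqM m) // -(uniqM m').
Qed.

(* An element that is a unit at [m] and locally a multiple of [d] at every
   other maximal ideal containing [d]. *)
Lemma h_local_isolate m d : h_local R -> d != 0 -> maximal_ideal m ->
  exists2 t, t \notin m & forall m', maximal_ideal m' -> m' <> m ->
    exists2 b, b \notin m' & exists r, b * t = r * d.
Proof.
move=> hR d0 mm; have pm := maximal_ideal_prime mm.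
have [s sE] : exists s : seq {classic ideal R},
    [set m' | maximal_ideal m' /\ d \in m'] = [set` s].
  by apply/finite_seqP; exact: (proj2 hR d d0).
(* [t] collects a separating factor for each of the finitely many maximal ideals other than [m] that
   contain [d]. *)
have [t tm tP] : exists2 t, t \notin m & forall m' : {classic ideal R}, m' \in s ->
    maximal_ideal m' -> m' <> m -> exists2 b, b \notin (m' : ideal R) & exists r, b * t = r * d.
  elim: {sE} s => [|m' s [t tm IH]]; first by exists 1 => //; case: mm.
  have [mm'|nm'] := pselect (maximal_ideal m' /\ m' <> m); last first.
    exists t => // m''; rewrite inE => /predU1P[->|/IH //].
    by move=> ? ?; case: nm'.
  have [a am [b bm' [r E]]] := h_local_separate hR d0 mm mm'.1 mm'.2.
  exists (a * t) => [|m'']; first exact: prime_ideal_notinM.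
  rewrite inE => /predU1P[-> _ _|m's mm'' neq].
    by exists b => //; exists (r * t); rewrite mulrA E mulrAC.
  have [b' b'm [r' E']] := IH m'' m's mm'' neq.
  by exists b' => //; exists (a * r'); rewrite mulrCA E' mulrA.
exists t => // m' mm' neq; have [dm'|dm'] := boolP (d \in m').
  by apply: tP => //; have : [set` s] m' by rewrite -sE.
by exists d => //; exists t; rewrite mulrC.
Qed.

(* Local inclusion at a single maximal ideal globalises: [t] kills, modulo [d],
   everything away from [m]. *)
Lemma h_local_residual (A B : ideal R) m d : h_local R ->
  d != 0 -> d \in B -> maximal_ideal m ->
  (forall x, x \in A -> exists2 s, s \notin m & s * x \in B) ->
  exists2 t, t \notin m & forall x, x \in A -> t * x \in B.
Proof.
move=> hR d0 dB mm loc; have [t tm tP] := h_local_isolate hR d0 mm.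
exists t => // x xA.
(* The conductor of [t * x] into [B] lies in no maximal ideal: [loc] shows this at [m], the choice
   of [t] elsewhere. *)
have [||C CP] := @ideal_exists (fun z => z * (t * x) \in B).
- by rewrite mul0r; exact: ideal0.
- by move=> a y z yC zC; rewrite mulrDl -mulrA; apply: idealD => //; apply: idealMl.
have [|C1] := boolP ((1 : R) \in C); first by move=> /CP; rewrite mul1r.
have [m' mm' Cm'] := exists_maximal_ideal C1.
suff [c cm' cC] : exists2 c, c \notin m' & c * (t * x) \in B.
  by move: cm'; rewrite Cm' //; exact/CP.
have [->|neq] := pselect (m' = m).
  by have [s sm sB] := loc x xA; exists s => //; rewrite mulrCA; apply: idealMl.
have [b bm' [r E]] := tP m' mm' neq.
by exists b => //; rewrite mulrA E mulrAC; apply: idealMl.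
Qed.

(** The claim is that the conductors (B : A) and (A : B) sum to R. If a maximal [m] contained both,
    [h_local_residual] would yield [x] in [A] and [y] in [B] with (B : x) and (A : y) inside [m];
    comparing [x] with [y] then puts both [s] and [1 - s] in [m]. *)
Lemma ideals_comparable (A B : ideal R) d : h_local R -> prufer R ->
  d != 0 -> d \in A -> d \in B ->
  exists s, (forall x, x \in A -> s * x \in B) /\
            (forall y, y \in B -> (1 - s) * y \in A).
Proof.
move=> hR pR d0 dA dB.
have [||C CP] := @ideal_exists (fun z => exists s t, z = s + t /\
  ((forall x, x \in A -> s * x \in B) /\ (forall y, y \in B -> t * y \in A))).
- exists 0, 0; rewrite addr0.
  by split=> //; split=> x _; rewrite mul0r; exact: ideal0.
- move=> a _ _ [s [t [-> [sP tP]]]] [s' [t' [-> [sP' tP']]]].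
  exists (a * s + s'), (a * t + t'); rewrite mulrDr addrACA; split=> //.
  by split=> x xA; rewrite mulrDl -mulrA; apply: idealD; auto; apply: idealMl; auto.
have [/CP[s [t [E [sP tP]]]]|C1] := boolP ((1 : R) \in C).
  by exists s; split=> // y /tP; rewrite E addrC addKr.
have [m mm Cm] := exists_maximal_ideal C1.
have [x xA xP] : exists2 x, x \in A & forall s, s * x \in B -> s \in m.
  apply: contrapT => nex.
  have [x xA|t tm tP] := h_local_residual (A := A) hR d0 dB mm.
    apply: contrapT => nex'; apply: nex; exists x => // s sB.
    by apply/negPn/negP => sm; apply: nex'; exists s.
  move/negP: tm; apply; apply/Cm/CP; exists t, 0; rewrite addr0.
  by do 2!split=> //; move=> y _; rewrite mul0r; exact: ideal0.
have [y yB yP] : exists2 y, y \in B & forall s, s * y \in A -> s \in m.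
  apply: contrapT => nex.
  have [y yB|t tm tP] := h_local_residual (A := B) hR d0 dA mm.
    apply: contrapT => nex'; apply: nex; exists y => // s sA.
    by apply/negPn/negP => sm; apply: nex'; exists s.
  move/negP: tm; apply; apply/Cm/CP; exists 0, t; rewrite add0r.
  by do 2!split=> //; move=> z _; rewrite mul0r; exact: ideal0.
have [s [[r E] [r' E']]] := prufer_comparable x y pR.
have sm : s \in m by apply: yP; rewrite E; apply: idealMl.
have sm' : 1 - s \in m by apply: xP; rewrite E'; apply: idealMl.
by have [/negP[]] := mm; rewrite -(subrK s 1); apply: idealD.
Qed.

End Ideals.

(** * Splitting off pure rank-one submodules of direct sums of ideals *)

Section DirectSums.
Variable R : idomainType.

(* Equivalently, the pure submodule generated by any nonzero [w] is a direct
   summand; [lambda / lambda w] is the coefficient of the retraction on [w]. *)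
Definition splits_lines (A : lmodType R) := forall w : A, w != 0 ->
  exists2 lambda : {linear A -> R^o}, lambda w != 0 &
    forall z, exists y, lambda w *: y = lambda z *: w.

(* [lambda / D] takes its values in the intersection of the fractional ideals
   [(u j)^-1 J j], which over a valuation domain would be one of them. *)
Lemma dsum_line_functional (I : Type) (J : I -> ideal R) (u : I -> R^o)
    (i0 : I) (l : seq {classic I}) : h_local R -> prufer R ->
  (forall i, u i \in J i) -> u i0 != 0 -> (forall i, i \in l -> u i != 0) ->
  exists2 D : R, D != 0 & exists lambda : {linear (I -> R^o) -> R^o},
    lambda u = D /\ forall z, (forall i, z i \in J i) ->
      forall j, j \in l -> exists2 c : R, c \in J j & lambda z * u j = D * c.
Proof.
move=> hR pR uJ u0; elim: l => [|k l IH] ul.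
  pose ev (z : I -> R^o) := z i0.
  have evl : linear ev by [].
  by exists (u i0) => //; exists (mk_linear evl).
have [|D D0 [lam [lamu lamP]]] := IH.
  by move=> i il; apply: ul; rewrite inE il orbT.
have uk0 : (u k : R) != 0 by apply: ul; rewrite inE eqxx.
(* Divided by [D * u k], [A] becomes the set of fractions r / D lying in (u j)^-1 J j for all [j] in
   [l], and [B] becomes (u k)^-1 J k. *)
have [||A AP] := @ideal_exists R (fun x => exists2 r : R,
    (forall j, j \in l -> exists2 c : R, c \in J j & r * u j = D * c) & x = r * u k).
- exists 0; last by rewrite mul0r.
  by move=> j _; exists 0; [exact: ideal0|rewrite mul0r mulr0].
- move=> a _ _ [r rP ->] [s sP ->]; exists (a * r + s); last by rewrite mulrDl mulrA.
  move=> j jl; have [c cJ rE] := rP j jl; have [e eJ sE] := sP j jl.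
  exists (a * c + e); first by apply: idealD => //; apply: idealMl.
  by rewrite mulrDl -mulrA rE sE mulrDr mulrCA.
have [||B BP] := @ideal_exists R (fun x => exists2 c : R, c \in J k & x = D * c).
- by exists 0; [exact: ideal0|rewrite mulr0].
- move=> a _ _ [c cJ ->] [e eJ ->]; exists (a * c + e).
    by apply: idealD => //; apply: idealMl.
  by rewrite mulrDr mulrCA.
have Duk0 : D * u k != 0 by rewrite mulf_neq0.
have [||s [sAB sBA]] := @ideals_comparable R A B (D * u k) hR pR Duk0.
- by apply/AP; exists D => // j _; exists (u j).
- by apply/BP; exists (u k).
(* Over the denominator [D * u k], this mixes [lam z / D] and [z k / u k] with weights [s] and
   [1 - s]. For [z] in the sum, [s] moves the first term from [A] into [B] and [1 - s] the second
   from [B] into [A], so both satisfy the old conditions and the new one. *)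
pose mu (z : I -> R^o) : R^o := s * (lam z * u k) + (1 - s) * (D * z k).
have mul : linear mu.
  move=> a x y; rewrite /mu linearP; move: (1 - s) => t.
  rewrite -[a *: lam x]/(a * lam x) -[(a *: x + y) k]/(a * x k + y k).
  rewrite -[a *: (_ + _)]/(a * (_ + _)) !(mulrDl, mulrDr) -!mulrA addrACA.
  by rewrite !(mulrCA _ a).
exists (D * u k) => //; exists (mk_linear mul).
split=> [|z zJ j]; rewrite /mk_linear /=.
  by rewrite /mu lamu -mulrDl addrC subrK mul1r.
have lamA : s * (lam z * u k) \in B.
  by apply: sAB; apply/AP; exists (lam z) => //; exact: lamP.
have zB : (1 - s) * (D * z k) \in A by apply: sBA; apply/BP; exists (z k).
rewrite inE => /predU1P[->|jl]; rewrite /mu mulrDl.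
  have /BP[c cJ ->] := lamA; exists (c + (1 - s) * z k).
    by apply: idealD => //; apply: idealMl.
  by rewrite mulrDr; congr (_ + _); rewrite ?[_ * (D * _)]mulrCA mulrAC.
have [c cJ cE] := lamP z zJ j jl; have /AP[r rP rE] := zB.
have [e eJ eE] := rP j jl; exists (s * c + e).
  by apply: idealD => //; apply: idealMl.
rewrite mulrDr rE [r * _ * _]mulrAC eE [D * e * _]mulrAC; congr (_ + _).
have alg (x y t : R) : x * t = D * c -> s * (x * y) * t = D * y * (s * c).
  by move=> xt; rewrite -mulrA [x * y * t]mulrAC xt [D * c * y]mulrAC mulrCA.
exact: alg.
Qed.

Lemma dsum_splits_lines (I : Type) (J : I -> ideal R) :
  h_local R -> prufer R -> splits_lines (submod_of (dsum J)).
Proof.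
move=> hR pR w w0; have /asboolP[] := valP w; set u := val w => finu uJ.
have [i0 ui0] : exists i, u i != 0.
  apply: contrapT => nex; move/eqP: w0; apply; apply: val_inj.
  by apply/funext => i; apply: contrapT => /eqP ui; apply: nex; exists i.
have [l lE] : exists l : seq {classic I}, [set i | u i != 0] = [set` l].
  exact/finite_seqP.
have [i il|D D0 [lam [lamu lamP]]] := dsum_line_functional (l := l) hR pR uJ ui0.
  by have : [set i | u i != 0] i by rewrite lE.
pose mu (z : submod_of (dsum J)) := lam (val z).
have mul : linear mu by move=> a x y; rewrite /mu !linearP.
exists (mk_linear mul); rewrite /mk_linear /= /mu lamu //.
move=> z; have /asboolP[_ zJ] := valP z.
have ex i : exists c : R, c \in J i /\ lam (val z) * u i = D * c.
  have [ui|ui] := eqVneq (u i) 0.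
    by exists 0; split; [exact: ideal0|rewrite ui !mulr0].
  have [|c cJ cE] := lamP (val z) zJ i; last by exists c.
  by have : [set` l] i by rewrite -lE.
have [c cP] := choice ex.
(* Where [u] vanishes, so does [D * c], hence [c]: its support is finite too. *)
have cD : (c : I -> R^o) \in dsum J.
  apply/asboolP; split=> [|i]; last by have [] := cP i.
  apply: sub_finite_set finu => i /=; apply: contra_neq => ui.
  by have [_] := cP i; rewrite ui mulr0 => /esym/eqP; rewrite mulf_eq0 (negPf D0) => /eqP.
exists (exist _ (c : I -> R^o) cD); apply: val_inj.
by apply/funext => i /=; have [_ E] := cP i; exact: esym.
Qed.

Lemma iso_dsum_splits_lines (A : lmodType R) :
  h_local R -> prufer R -> iso_dsum_ideals A -> splits_lines A.
Proof.
move=> hR pR [I [J [f [g gK fK]]]] w w0.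
have [|lam lamw lamP] := dsum_splits_lines (J := J) hR pR (w := f w).
  by apply: contra_neq w0 => fw0; rewrite -[w]gK fw0 -(linear0 f) gK.
exists (lam \o f : {linear _ -> _}) => //= z.
have [y yE] := lamP (f z); exists (g y).
by apply: (can_inj gK); rewrite !linearZ /= fK.
Qed.

Lemma iso_dsum_functional (A : lmodType R) (w : A) : iso_dsum_ideals A -> w != 0 ->
  exists phi : {linear A -> R^o}, phi w != 0.
Proof.
move=> [I [J [f [g gK fK]]]] w0.
have [i fwi] : exists i, val (f w) i != 0.
  apply: contrapT => nex; move/eqP: w0; apply; apply: (can_inj gK).
  rewrite linear0; apply: val_inj.
  by apply/funext => i; apply: contrapT => /eqP ui; apply: nex; exists i.
pose phi (z : A) := val (f z) i.
have phil : linear phi by move=> a x y; rewrite /phi !linearP.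
by exists (mk_linear phil).
Qed.

End DirectSums.

(** * Pure closures of finite sets in a torsion-free module *)

Section PureClosures.
Variables (R : idomainType) (A : lmodType R).
Hypothesis tfA : torsion_free A.
Implicit Types (a b : R) (x y w : A) (v : nat -> A) (k : nat).

(** The trace on [A] of a span over the fraction field, with the denominator [a] cleared. *)
Definition in_pure_span v k x := exists2 a, a != 0 &
  exists c : nat -> R, a *: x = \sum_(i < k) c i *: v i.

Definition in_pure_line w x := exists2 a, a != 0 & exists b, a *: x = b *: w.

Lemma torsion_free_inj a x y : a != 0 -> a *: x = a *: y -> x = y.
Proof.
move=> a0 E; have : a *: (x - y) = 0 by rewrite scalerBr E subrr.
by case/tfA => [/eqP|/eqP]; rewrite ?(negPf a0) // subr_eq0 => /eqP.
Qed.

Lemma scale_swap a b x : a *: (b *: x) = b *: (a *: x).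
Proof. by rewrite !scalerA mulrC. Qed.

Lemma in_pure_span0 v k : in_pure_span v k 0.
Proof.
exists 1; first exact: oner_neq0.
by exists (fun=> 0); rewrite scaler0 big1 // => i _; rewrite scale0r.
Qed.

Lemma in_pure_spanP v k b x y : in_pure_span v k x -> in_pure_span v k y ->
  in_pure_span v k (b *: x + y).
Proof.
move=> [a a0 [c cE]] [a' a'0 [c' c'E]].
exists (a * a'); first exact: mulf_neq0.
exists (fun i => b * a' * c i + a * c' i).
have E : a * a' * b = b * a' * a by rewrite mulrC (mulrC a) mulrA.
rewrite scalerDr scalerA E.
rewrite -[_ *: x]scalerA cE -[_ *: y]scalerA c'E !scaler_sumr -big_split /=.
by apply: eq_bigr => i _; rewrite scalerDl !scalerA.
Qed.

Lemma in_pure_spanS v k x : in_pure_span v k x -> in_pure_span v k.+1 x.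
Proof.
move=> [a a0 [c cE]]; exists a => //; exists (fun i => if (i < k)%N then c i else 0).
rewrite big_ord_recr /= ltnn scale0r addr0 cE.
by apply: eq_bigr => i _; rewrite ltn_ord.
Qed.

Lemma in_pure_span_le v k k' x : (k <= k')%N ->
  in_pure_span v k x -> in_pure_span v k' x.
Proof.
by move=> /subnK <-; elim: (k' - k)%N => // n IH /IH; rewrite addSn; exact: in_pure_spanS.
Qed.

Lemma in_pure_span_gen v k : in_pure_span v k.+1 (v k).
Proof.
exists 1; first exact: oner_neq0.
exists (fun i => (i == k)%:R); rewrite big_ord_recr /= eqxx big1 ?add0r // => i _.
by rewrite ltn_eqF ?scale0r.
Qed.

Lemma in_pure_span_pure v k a x : a != 0 ->
  in_pure_span v k (a *: x) -> in_pure_span v k x.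
Proof.
move=> a0 [b b0 E]; exists (b * a); first exact: mulf_neq0.
by rewrite -scalerA.
Qed.

Lemma in_pure_line_span v k w x : in_pure_span v k w -> in_pure_line w x ->
  in_pure_span v k x.
Proof.
move=> wN [a a0 [b E]]; apply: (in_pure_span_pure a0); rewrite E -[_ *: w]addr0.
by apply: in_pure_spanP => //; exact: in_pure_span0.
Qed.

Lemma in_pure_line0 w : in_pure_line w 0.
Proof. by exists 1; [exact: oner_neq0|exists 0; rewrite scaler0 scale0r]. Qed.

Lemma in_pure_lineP w b x y : in_pure_line w x -> in_pure_line w y ->
  in_pure_line w (b *: x + y).
Proof.
move=> [a a0 [c cE]] [a' a'0 [c' c'E]].
exists (a * a'); first exact: mulf_neq0.
exists (b * a' * c + a * c').
have E : a * a' * b = b * a' * a by rewrite mulrC (mulrC a) mulrA.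
rewrite scalerDr scalerA E.
by rewrite -[_ *: x]scalerA cE -[_ *: y]scalerA c'E scalerDl !scalerA.
Qed.

Lemma in_pure_line_nul x : in_pure_line 0 x -> x = 0.
Proof. by move=> [a a0 [b]]; rewrite scaler0 => /tfA[/eqP|//]; rewrite (negPf a0). Qed.

(** Torsion-freeness makes the [y] of [splits_lines] unique for each [z], so that choosing it is
    linear in [z]. *)
Lemma splits_lines_retraction w : splits_lines A ->
  exists sigma : {linear A -> A}, (forall x, in_pure_line w (sigma x)) /\
    forall x, in_pure_line w x -> sigma x = x.
Proof.
(* The zero case does occur: [v k] may already lie in the pure span of its predecessors. *)
move=> sA; have [->|w0] := eqVneq w 0.
  exists (\0 : {linear A -> A}); split=> [x|x /in_pure_line_nul -> //].
  exact: in_pure_line0.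
have [lam lamw /choice[sigma sigmaE]] := sA w w0.
have sl : linear sigma.
  move=> a x y; apply: (torsion_free_inj lamw).
  rewrite sigmaE linearP scalerDl scalerDr sigmaE [lam w *: (_ *: _)]scale_swap sigmaE.
  by rewrite scalerA.
exists (mk_linear sl); rewrite /mk_linear /=; split=> [x|x [a a0 [b E]]].
  by exists (lam w) => //; exists (lam x).
apply: (torsion_free_inj a0); apply: (torsion_free_inj lamw).
rewrite E scale_swap sigmaE !scalerA.
have -> : a * lam x = b * lam w.
  by have := congr1 lam E; rewrite !linearZ.
by rewrite mulrC.
Qed.

Definition pure_span_retraction v k (rho : A -> A) :=
  (forall x, in_pure_span v k (rho x)) /\
  forall x, in_pure_span v k x -> rho x = x.

(** Applying 1 - [rho] to a relation between [x] and the first [k.+1] terms kills every term but the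
    last. *)
Lemma pure_span_retraction_line v k (rho : {linear A -> A}) x :
  pure_span_retraction v k rho -> in_pure_span v k.+1 x ->
  in_pure_line (v k - rho (v k)) (x - rho x).
Proof.
move=> [_ rhoid] [a a0 [c cE]]; exists a => //; exists (c k).
rewrite !scalerBr -!linearZ /= cE big_ord_recr /= linearD opprD addrACA.
rewrite [rho (\sum__ _)]rhoid ?subrr ?add0r //.
by exists 1; [exact: oner_neq0|exists c; rewrite scale1r].
Qed.

(** Given [rho] for [k], the remainder 1 - [rho] sends the next pure span into the pure line of
    [v k - rho (v k)]; retracting that remainder onto the line by [sigma] and adding [rho] gives the
    next retraction. *)
Lemma splits_lines_pure_span v k : splits_lines A ->
  exists rho : {linear A -> A}, pure_span_retraction v k rho.
Proof.
move=> sA; elim: k => [|k [rho rhoP]].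
  exists (\0 : {linear A -> A}); split=> [x|x [a a0 [c]]]; first exact: in_pure_span0.
  by rewrite big_ord0 => /tfA[/eqP|//]; rewrite (negPf a0).
have [sigma [sigmaL sigmaid]] := splits_lines_retraction (v k - rho (v k)) sA.
pose tau x := rho x + sigma (x - rho x).
have tl : linear tau.
  move=> a x y; rewrite /tau linearP scalerDr addrACA; congr (_ + _).
  by rewrite -[RHS]linearP scalerBr opprD addrACA.
exists (mk_linear tl); rewrite /mk_linear /=; split=> x; last first.
  move=> xN; rewrite /= /tau sigmaid; first by rewrite addrC subrK.
  exact: pure_span_retraction_line.
have [rhoN _] := rhoP.
rewrite /= /tau -[rho x]scale1r; apply: in_pure_spanP; first exact: in_pure_spanS.
apply: in_pure_line_span (sigmaL _); rewrite addrC -scaleN1r.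
by apply: in_pure_spanP; [exact: in_pure_spanS|exact: in_pure_span_gen].
Qed.

End PureClosures.

(** * Rank-one steps between successive pure closures *)

Section CountableChains.
Variables (R : idomainType) (M : lmodType R).
Hypothesis tfM : torsion_free M.
Implicit Types (a b : R) (x y z w : M) (v : nat -> M) (k : nat).

(* [in_pure_span v k.+1] is the direct sum of [in_pure_span v k] and the pure
   rank-one submodule of [w], and [phi] embeds the latter in [R]. *)
Definition pure_span_step v k w (phi : M -> R) :=
  [/\ forall x, in_pure_span v k.+1 x -> exists2 y, in_pure_span v k y &
        in_pure_line w (x - y),
      forall x, in_pure_span v k x -> in_pure_line w x -> x = 0,
      forall x, in_pure_line w x -> in_pure_span v k.+1 x,
      forall a x y, in_pure_line w x -> in_pure_line w y ->
        phi (a *: x + y) = a * phi x + phi y &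
      forall x, in_pure_line w x -> phi x = 0 -> x = 0].

Lemma pure_divides (N : submodClosed M) a x : pure N -> a != 0 ->
  a *: x \in N -> x \in N.
Proof.
move=> pN a0 axN.
have [||x' [x'N x'E]] := pN 1%N 1%N (const_mx a) (fun=> a *: x).
- by move=> i.
- by exists (fun=> x) => i; rewrite big_ord_recl big_ord0 addr0 mxE.
have := x'E ord0; rewrite big_ord_recl big_ord0 addr0 mxE.
by move=> /(torsion_free_inj tfM a0) <-.
Qed.

(** Purity of [N] puts the relevant pure closures of [M] inside [N], where retractions are
    available. *)
Lemma pure_span_step_exists (N : submodClosed M) v k :
  h_local R -> prufer R -> pure N -> iso_dsum_ideals (submod_of N) ->
  (forall i, (i <= k)%N -> v i \in N) ->
  exists w phi, pure_span_step v k w phi.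
Proof.
move=> hR pR pN isoN vN; pose A := submod_of N.
have tfA : torsion_free A.
  move=> a x /(congr1 val) /tfM[->|x0]; first by left.
  by right; apply: val_inj.
(* Terms outside [N] are replaced by 0; only the indices up to [k] matter. *)
pose v' i : A := insubd (0 : A) (v i).
have v'E i : (i <= k)%N -> val (v' i) = v i by move=> /vN; exact: insubdK.
have spanE j (X : A) : (j <= k.+1)%N ->
    in_pure_span v' j X <-> in_pure_span v j (val X).
  move=> jk; have sumE (c : nat -> R) :
      val (\sum_(i < j) c i *: v' i) = \sum_(i < j) c i *: v i.
    rewrite raddf_sum; apply: eq_bigr => i _ /=; rewrite v'E //.
    by rewrite -ltnS (leq_trans (ltn_ord i)).
  split=> -[a a0 [c E]]; exists a => //; exists c.
    by rewrite -sumE -E.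
  by apply: val_inj; rewrite sumE -E.
have lineE (W X : A) : in_pure_line W X <-> in_pure_line (val W) (val X).
  split=> -[a a0 [b E]]; exists a => //; exists b; last exact: val_inj.
  exact: (congr1 val E).
have spanN x : in_pure_span v k.+1 x -> x \in N.
  move=> [a a0 [c E]]; apply: (pure_divides pN a0); rewrite E.
  by apply: rpred_sum => i _; apply/rpredZ/vN; rewrite -ltnS.
have lineN (W : A) x : in_pure_line (val W) x -> x \in N.
  move=> [a a0 [b E]]; apply: (pure_divides pN a0); rewrite E.
  exact/rpredZ/(valP W).
have sA := iso_dsum_splits_lines hR pR isoN.
have [rho rhoP] := splits_lines_pure_span tfA v' k sA.
have [rhoN rhoid] := rhoP.
pose W := v' k - rho (v' k).
(* Hence an element common to the line of [W] and the [k]-th pure span is both killed and fixed by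
   [rho]. *)
have rhoW : rho W = 0 by rewrite linearB /= [rho (rho _)]rhoid // subrr.
have WN : in_pure_span v k.+1 (val W).
  apply/spanE => //; rewrite /W addrC -scaleN1r.
  by apply: in_pure_spanP; [exact: in_pure_spanS|exact: in_pure_span_gen].
have [phi phiW] : exists phi : {linear A -> R^o}, W = 0 \/ phi W != 0.
  have [W0|W0] := eqVneq W 0; first by exists (\0 : {linear A -> R^o}); left.
  by have [phi phiW] := iso_dsum_functional isoN W0; exists phi; right.
(* The default value 0 outside [N] is harmless, since the line of [W] lies in [N]. *)
exists (val W), (fun x => phi (insubd (0 : A) x)); split.
- move=> x xS; have xN := spanN x xS.
  pose X : A := exist _ x xN.
  exists (val (rho X)); first by apply/spanE.
  apply: (proj1 (lineE W (X - rho X))); apply: pure_span_retraction_line => //.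
  exact/spanE.
- move=> x xS xL; have xN := lineN W x xL; pose X : A := exist _ x xN.
  have XS : in_pure_span v' k X by apply/spanE.
  have [a a0 [b E]] : in_pure_line W X by apply/lineE.
  have : a *: X = 0 by rewrite -(rhoid X XS) -linearZ /= E linearZ /= rhoW scaler0.
  by case/tfA => [/eqP|/(congr1 val) //]; rewrite (negPf a0).
- by move=> x; exact: in_pure_line_span.
- move=> a x y xL yL; have xN := lineN W x xL; have yN := lineN W y yL.
  have -> : insubd (0 : A) (a *: x + y) = a *: insubd (0 : A) x + insubd (0 : A) y.
    apply: val_inj; rewrite /= !insubdK //.
    by apply: rpredD => //; apply: rpredZ.
  by rewrite linearP.
move=> x xL; have xN := lineN W x xL; pose X : A := exist _ x xN.
have -> : insubd (0 : A) x = X by apply: val_inj; rewrite insubdK.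
have [a a0 [b E]] : in_pure_line W X by apply/lineE.
move=> phiX; suff /(congr1 val) : X = 0 by [].
apply: (torsion_free_inj tfA a0); rewrite scaler0 E.
case: phiW => [->|phiW]; first by rewrite scaler0.
have := congr1 phi E; rewrite !linearZ /= phiX scaler0 => /esym/eqP.
by rewrite [_ *: _]/(b * _) mulf_eq0 (negPf phiW) orbF => /eqP ->; rewrite scale0r.
Qed.

(** * Assembling the steps into a direct sum decomposition *)

Section Assembly.
Variables (v w : nat -> M) (phi : nat -> M -> R).
Hypothesis vcover : forall x, exists k, in_pure_span v k x.
Hypothesis stepP : forall k, pure_span_step v k (w k) (phi k).

Definition line_decomposition x (c : nat -> M) :=
  (forall k, in_pure_line (w k) (c k)) /\
  exists K, (forall k, (K <= k)%N -> c k = 0) /\ x = \sum_(k < K) c k.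

Lemma line_decomposition_widen x c K :
  (forall k, (K <= k)%N -> c k = 0) -> x = \sum_(k < K) c k ->
  forall K', (K <= K')%N -> x = \sum_(k < K') c k.
Proof.
move=> c0 -> K' /subnKC <-; rewrite big_split_ord /= [X in _ + X]big1 ?addr0 // => i _.
by rewrite c0 // leq_addr.
Qed.

Lemma line_decompositionP a x y c e :
  line_decomposition x c -> line_decomposition y e ->
  line_decomposition (a *: x + y) (fun k => a *: c k + e k).
Proof.
move=> [cL [K [cK xE]]] [eL [K' [eK yE]]]; split=> [k|]; first exact: in_pure_lineP.
exists (maxn K K'); split=> [k|].
  by rewrite geq_max => /andP[/cK -> /eK ->]; rewrite scaler0 addr0.
rewrite (line_decomposition_widen cK xE (leq_maxl K K')).
rewrite (line_decomposition_widen eK yE (leq_maxr K K')).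
by rewrite scaler_sumr -big_split.
Qed.

Lemma line_decomposition_exists x : exists c, line_decomposition x c.
Proof.
have [k xS] := vcover x.
(* Fixing the cutoff at [k] lets the induction peel off one component at a time. *)
suff [c cL [c0 xE]] : exists2 c, (forall i, in_pure_line (w i) (c i)) &
    (forall i, (k <= i)%N -> c i = 0) /\ x = \sum_(i < k) c i.
  by exists c; split=> //; exists k.
elim: k x xS => [|k IH] x.
  move=> [a a0 [c]]; rewrite big_ord0 => /tfM[/eqP|->]; first by rewrite (negPf a0).
  exists (fun=> 0); last by rewrite big_ord0.
  by move=> i; exact: in_pure_line0.
have [splitS _ _ _ _] := stepP k.
move=> /splitS[y /IH[c cL [c0 yE]] zL].
exists (fun i => if i == k then x - y else c i).
  by move=> i; case: eqP => [->|].
split=> [i ki|]; first by rewrite gtn_eqF // c0 // ltnW.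
rewrite big_ord_recr /= eqxx (eq_bigr (fun i : 'I_k => c i)) -?yE ?[y + _]addrC ?subrK //.
by move=> i _; rewrite ltn_eqF.
Qed.

(** The last component is minus the sum of the earlier ones, hence lies in the previous pure span as
    well as in its own line, and vanishes; then the cutoff drops by one. *)
Lemma line_decomposition0 c : line_decomposition 0 c -> c = fun=> 0.
Proof.
move=> [cL [K [cK cE]]]; apply/funext.
elim: K cK cE => [|K IH] cK cE i; first exact: cK.
suff cK0 : c K = 0.
  apply: IH => [j|]; first by rewrite leq_eqVlt => /predU1P[<-|/cK].
  by move: cE; rewrite big_ord_recr /= cK0 addr0.
have [_ triv _ _ _] := stepP K; apply: triv => //.
have -> : c K = -1 *: (\sum_(j < K) c j) + 0.
  rewrite addr0 scaleN1r; apply/eqP; rewrite -addr_eq0 addrC eq_sym.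
  by apply/eqP; move: cE; rewrite big_ord_recr.
apply: in_pure_spanP; last exact: in_pure_span0.
elim/big_ind: _ => [|x y xS yS|j _]; first exact: in_pure_span0.
  by rewrite -[x]scale1r; exact: in_pure_spanP.
have [_ _ sub _ _] := stepP j.
by apply: in_pure_span_le (sub _ (cL j)).
Qed.

(** The ideal [J k] is the image under [phi k] of the [k]-th line, and [x] goes to the family of
    images of its components. *)
Lemma iso_dsum_of_steps : iso_dsum_ideals M.
Proof.
have phiP k a x y := let: And5 _ _ _ H _ := stepP k in H a x y.
have phi_inj k x := let: And5 _ _ _ _ H := stepP k in H x.
have phi0 k : phi k 0 = 0.
  have := phiP k 1 0 0 (in_pure_line0 _) (in_pure_line0 _).
  by rewrite scaler0 addr0 mul1r => /esym/eqP; rewrite -subr_eq0 addrK => /eqP.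
have exJ k : exists J : ideal R, forall r : R,
    r \in J <-> exists2 x, in_pure_line (w k) x & phi k x = r.
  apply: ideal_exists; first by exists 0 => //; exact: in_pure_line0.
  move=> a _ _ [x xL <-] [y yL <-]; exists (a *: x + y); last exact: phiP.
  exact: in_pure_lineP.
have [J JP] := choice exJ.
have [C CP] := choice line_decomposition_exists.
have Cuniq x c : line_decomposition x c -> C x = c.
  move=> xc; apply/funext => k.
  have := line_decompositionP (-1) xc (CP x); rewrite scaleN1r addNr.
  move=> /line_decomposition0/(congr1 (fun f => f k)) /=.
  by rewrite scaleN1r addrC => /eqP; rewrite subr_eq0 => /eqP.
pose h x : nat -> R^o := fun k => phi k (C x k).
have hD x : h x \in dsum J.
  have [CL [K [CK _]]] := CP x.
  apply/asboolP; split=> [|k]; last by apply/JP; exists (C x k).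
  apply: (@sub_finite_set _ _ `I_K) => // k /= hk; rewrite ltnNge.
  by apply: contra_neqN hk => /CK; rewrite /h => ->; exact: phi0.
pose f x : submod_of (dsum J) := exist _ (h x) (hD x).
have fl : linear f.
  move=> a x y; apply: val_inj; apply/funext => k /=; rewrite /h.
  rewrite (Cuniq _ _ (line_decompositionP a (CP x) (CP y))).
  by rewrite phiP //; [have [] := CP x|have [] := CP y].
have finj x : f x = 0 -> x = 0.
  move=> /(congr1 val) fx; have [CL [K [_ ->]]] := CP x.
  apply: big1 => k _; apply: (phi_inj k) => //.
  by have /= := congr1 (fun g : nat -> R^o => g k) fx.
have fsurj (g : submod_of (dsum J)) : exists x, f x = g.
  have /asboolP[gfin gJ] := valP g.
  have exc k : exists x, in_pure_line (w k) x /\ phi k x = val g k.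
    by have /JP[x] := gJ k; exists x.
  have [c cP] := choice exc.
  have [l lE] : exists l : seq nat, [set k | val g k != 0] = [set` l].
    exact/finite_seqP.
  (* The cutoff is one past the largest index in the support of [g], and 0 if the support is
     empty. *)
  have c0 k : (\max_(i <- l) i.+1 <= k)%N -> c k = 0.
    move=> lk; have [cL cE] := cP k; apply: (phi_inj k) => //; rewrite cE.
    apply/eqP/negPn/negP => gk; have kl : [set` l] k by rewrite -lE.
    by move: lk; rewrite leqNgt (@leq_bigmax_seq _ l xpredT S k).
  exists (\sum_(k < \max_(i <- l) i.+1) c k); apply: val_inj; apply/funext => k /=.
  rewrite /h (Cuniq _ c); first by have [] := cP k.
  split=> [i|]; first by have [] := cP i.
  by exists (\max_(i <- l) i.+1)%N.
have [g gK] := choice fsurj.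
exists nat, J, (mk_linear fl), g => [x|y]; rewrite /mk_linear /=; last exact: gK.
apply/eqP; rewrite -subr_eq0; apply/eqP/finj.
by rewrite -scaleN1r addrC fl gK scaleN1r addNr.
Qed.

End Assembly.
End CountableChains.

(** * From countable rank to a spanning sequence, and the conclusion *)

Lemma max_lin_indep_span (R : idomainType) (A : lmodType R) (B : set A) (x : A) :
  max_lin_indep B -> exists2 a : R, a != 0 & exists (s : seq A) (c : A -> R),
    (forall y, y \in s -> B y) /\ a *: x = \sum_(y <- s) c y *: y.
Proof.
move=> [Bfree Bmax]; have [Bx|nBx] := pselect (B x).
  exists 1; first exact: oner_neq0.
  exists [:: x], (fun=> 1); rewrite big_seq1; split=> // y.
  by rewrite inE => /eqP ->.
apply: contrapT => nex; apply: nBx.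
(* With no nonzero multiple of [x] in the span of [B], adjoining [x] keeps independence, so
   maximality forces [x] into [B]. *)
have <- : B `|` [set x] = B; [|by right].
apply: Bmax; last by move=> y; left.
move=> s c us sB s0.
have [xs|xs] := boolP (x \in s); last first.
  apply: (Bfree s c us) => // y ys; have [//|yx] := sB y ys.
  by move: xs; rewrite -yx ys.
have rB y : y \in rem x s -> B y.
  rewrite mem_rem_uniq // inE => /andP[yx /sB[//|/= yx']].
  by rewrite yx' eqxx in yx.
move: s0; rewrite (big_rem x xs) /= => s0.
have [cx0|cx0] := eqVneq (c x) 0; last first.
  case: nex; exists (c x) => //; exists (rem x s), (fun y => - c y); split=> //.
  move/eqP: s0; rewrite addr_eq0 => /eqP ->; rewrite -sumrN.
  by apply: eq_bigr => y _; rewrite scaleNr.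
rewrite cx0 scale0r add0r in s0.
move=> y ys; have [->//|yx] := eqVneq y x.
by apply: (Bfree _ c (rem_uniq x us) rB s0); rewrite mem_rem_uniq // inE yx.
Qed.

Lemma countable_enum (T : Type) (t : T) (B : set T) : countable B ->
  exists v : nat -> T, forall y, B y -> exists k, v k = y.
Proof.
move=> /countable_injP[f finj].
have [|v vP] := @choice nat T (fun k x => forall y, B y -> f y = k -> x = y).
  move=> k; have [[y [By fy]]|nex] := pselect (exists y, B y /\ f y = k).
    by exists y => z Bz fz; apply: finj; rewrite ?inE // fy fz.
  by exists t => y By fy; case: nex; exists y.
by exists v => y By; exists (f y); exact: vP.
Qed.

Lemma countable_rank_cover (R : idomainType) (M : lmodType R)
    (F : nat -> submodClosed M) :
  (forall x, exists n, x \in F n) ->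
  (forall n, countable_rank (submod_of (F n))) ->
  exists v : nat -> M, forall x, exists k, in_pure_span v k x.
Proof.
move=> Fcover Frank.
have exB n : exists B : set M, countable B /\ forall x, x \in F n ->
    exists2 a : R, a != 0 & exists s : seq (R * M),
      (forall p, p \in s -> B p.2) /\ a *: x = \sum_(p <- s) p.1 *: p.2.
  have [B [Bmax Bct]] := Frank n; exists (val @` B); split.
    exact: sub_countable (card_image_le _ _) Bct.
  move=> x xF; pose X : submod_of (F n) := exist _ x xF.
  have [a a0 [s [c [sB E]]]] := max_lin_indep_span X Bmax.
  exists a => //; exists [seq (c y, val y) | y <- s]; split.
    by move=> _ /mapP[y ys ->]; exists y => //; exact: sB.
  by rewrite big_map; have := congr1 val E; rewrite raddf_sum.
have [B BP] := choice exB.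
(* The sequence enumerates the union of maximal independent sets of all the [F n], which need not be
   independent. *)
have [|v vP] := @countable_enum M 0 (\bigcup_n B n).
  by apply: bigcup_countable => // n _; have [] := BP n.
exists v => x; have [n xF] := Fcover x.
have [_ /(_ x xF)[a a0 [s [sB E]]]] := BP n.
suff [k xk] : exists k, in_pure_span v k (a *: x).
  by exists k; exact: in_pure_span_pure xk.
rewrite {}E; elim: s sB => [|[r y] s IH] sB.
  by exists 0%N; rewrite big_nil; exact: in_pure_span0.
have [|k kP] := IH; first by move=> z zs; apply: sB; rewrite inE zs orbT.
have [|j yE] := vP y.
  by exists n => //; apply: (sB (r, y)); rewrite inE eqxx.
exists (maxn j.+1 k); rewrite big_cons; apply: in_pure_spanP => /=.
  by rewrite -yE; apply: in_pure_span_le (leq_maxl _ _) _; exact: in_pure_span_gen.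
exact: in_pure_span_le (leq_maxr _ _) kP.
Qed.

Theorem theorem9 (R : idomainType) (hR : h_local R) (pR : prufer R)
    (M : lmodType R) (tfM : torsion_free M)
    (F : nat -> submodClosed M)
    (F0 : forall x : M, x \in F 0%N <-> x = 0)
    (Fasc : forall n : nat, {subset F n <= F n.+1})
    (Fcover : forall x : M, exists n : nat, x \in F n)
    (Fdsum : forall n : nat, iso_dsum_ideals (submod_of (F n)))
    (Frank : forall n : nat, countable_rank (submod_of (F n)))
    (Fpure : forall n : nat, pure (F n)) :
  iso_dsum_ideals M.
Proof.
have [v vcover] := countable_rank_cover Fcover Frank.
have Fmono n n' : (n <= n')%N -> {subset F n <= F n'}.
  by move=> /subnK <- x xF; elim: (n' - n)%N => // k; rewrite addSn; exact: Fasc.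
have vF k : exists n, forall i, (i <= k)%N -> v i \in F n.
  elim: k => [|k [n nP]].
    by have [n vn] := Fcover (v 0%N); exists n => i; rewrite leqn0 => /eqP ->.
  have [n' vn'] := Fcover (v k.+1); exists (maxn n n') => i.
  rewrite leq_eqVlt => /predU1P[->|/nP vi].
    exact: Fmono (leq_maxr n n') _ vn'.
  exact: Fmono (leq_maxl n n') _ vi.
(* [pure_span_step] speaks of [M] alone, so the members [F n] used for different [k] need no
   compatibility. *)
have step k : exists p : M * (M -> R), pure_span_step v k p.1 p.2.
  have [n nP] := vF k.
  have [w [phi H]] := pure_span_step_exists tfM hR pR (Fpure n) (Fdsum n) nP.
  by exists (w, phi).
have [p pP] := choice step.
exact: (iso_dsum_of_steps tfM vcover pP).
Qed.
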